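(* For $t\ge 0$, $$\gamma(a,t)\,\Gamma(1-a)=2\int_0^{\pi/2}\left(1-e^{-t\sec^2(\theta)}\right)\cot^{2a-1}(\theta)\,d\theta=\pi\csc(\pi a)-2\int_0^{\pi/2}e^{-t\sec^2(\theta)}\cot^{2a-1}(\theta)\,d\theta.$$
   Context: The lower incomplete gamma function is defined as $\gamma(s,x)=\int_0^x u^{s-1}e^{-u}\,du$, and $\Gamma$ is the gamma function. *)

(* Defs.v *)
From HB Require Import structures.
From mathcomp Require Export all_boot all_order all_algebra.
From mathcomp Require Export all_classical all_reals all_analysis.
Export Order.TTheory GRing.Theory Num.Theory.
Export numFieldNormedType.Exports.

Set Implicit Arguments.
Unset Strict Implicit.
Unset Printing Implicit Defensive.

#[global] Open Scope classical_set_scope.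
#[global] Open Scope ring_scope.

Section defs.
Context {R : realType}.
Local Notation mu := (@lebesgue_measure R).

(* Integrals of nonnegative functions are taken in \bar R, so that a divergent
   integral is +oo. The intervals are open because [powR], [cot] and [sec] take
   junk values at singular endpoints. *)

Definition lower_gamma (s x : R) : \bar R :=
  (\int[mu]_(u in `]0%R, x[) ((u `^ (s - 1) * expR (- u))%:E))%E.

(* Euler's integral: equal to the gamma function for s > 0 only (it is +oo for
   s <= 0). *)
Definition Gamma (s : R) : \bar R :=
  (\int[mu]_(u in `]0%R, +oo[) ((u `^ (s - 1) * expR (- u))%:E))%E.

Definition sec (x : R) : R := (cos x)^-1.
Definition csc (x : R) : R := (sin x)^-1.
Definition cot (x : R) : R := cos x / sin x.

End defs.

(* Main.v *)
Require Import Defs.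
From mathcomp Require Import ring lra measurable_realfun.

(** Why the theorem is true.  Substitute v = u tan^2 x in Euler's integral for
Gamma (1 - a).  All powers of u cancel against u^(a-1), the exponentials
e^(-u) and e^(-u tan^2 x) combine, and
<<
  u^(a-1) e^(-u) Gamma (1 - a)
    = int_0^(pi/2) 2 cot^(2a-1) x  sec^2 x  e^(-u sec^2 x) dx
>>
([Gamma_angle]).  Integrate over u in a set D and exchange the integrals, which
Tonelli's theorem allows since everything is nonnegative
([integral_gamma_mul_Gamma]).  What remains inside is the integral of
e^(-u sec^2 x) over D.  It is (1 - e^(-t sec^2 x)) / sec^2 x for D = ]0, t[,
which gives the first equality, and 1 / sec^2 x for D = ]0, +oo[, which gives
Gamma a * Gamma (1 - a) = 2 int_0^(pi/2) cot^(2a-1) x dx.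

For the second equality, cot^(2a-1) is the sum of the two integrands, so it only
remains to know that Gamma a * Gamma (1 - a) = pi / sin (pi a).  This value is
finite, which is what makes the subtraction in the extended reals legitimate.

The reflection formula comes from two sequences with opposite recurrences.  With
C_m(x) the integral of cos (2 x y) cos^m y over [0, pi/2], put
<<
  G_n = Gamma (n+1+a) Gamma (n+1-a) / Gamma (n+1)^2,   r_n = C_2n(a) / C_2n(0).
>>
The functional equation of Gamma gives G_(n+1) = (1 - a^2/(n+1)^2) G_n, and an
integration by parts gives r_n = (1 - a^2/(n+1)^2) r_(n+1).  Hence G_n r_n does
not depend on n ([rGamma_cos_moment_invariant]); for n = 0 its value is
Gamma a * Gamma (1 - a) * sin (pi a) / pi, because C_0 is explicit.  On the
other hand both G_n and r_n tend to 1: for G_n this is a form of the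
log-convexity of Gamma ([rGamma_mul_le], [rGamma_mul_ge]), and for r_n it says
that the mass of cos^m concentrates at 0 ([cos_moment_ratio_ge]).  So the
constant is 1.  Multiplying out the two recurrences would give Euler's product
for the sine; the invariant avoids infinite products. *)

(** * Substitution for nonnegative integrands on an open interval *)

Section substitution.
Context {R : realType}.
Local Notation mu := (@lebesgue_measure R).

Lemma is_derive_continuous (f df : R -> R) :
  (forall x : R, is_derive x 1 f (df x)) -> continuous f.
Proof.
move=> dF x; apply: differentiable_continuous; apply/derivable1_diffP.
by have [] := dF x.
Qed.

Lemma itvoo_bigcup (a b : R) : a < b ->
  \bigcup_n `[a + (b - a) / n.+2%:R, b - (b - a) / n.+2%:R]%classic =
  `]a, b[%classic.
Proof.
move=> ab; pose k n : R := (b - a) / n.+2%:R.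
have ba0 : 0 < b - a by rewrite subr_gt0.
have k0 n : 0 < k n by rewrite divr_gt0.
apply/seteqP; split=> [x [n _]|x] /=.
  rewrite !in_itv/= -/(k n) => /andP[ax xb].
  by have := k0 n; move=> ?; apply/andP; split; lra.
rewrite in_itv/= => /andP[ax xb].
pose d := Num.min (x - a) (b - x).
have d0 : 0 < d by rewrite lt_min !subr_gt0 ax.
have [n nd] : exists n : nat, (b - a) / d < n%:R.
  exists (Num.Def.archi_bound ((b - a) / d)).
  by apply: archi_boundP; rewrite divr_ge0// ltW.
exists n => //=; rewrite in_itv/= -/(k n).
have knd : k n <= d.
  rewrite /k ler_pdivrMr// mulrC -ler_pdivrMr// (le_trans (ltW nd))// ler_nat.
  by rewrite (leq_trans (leqnSn n)).
have : k n <= x - a by rewrite (le_trans knd)// ge_min lexx.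
have : k n <= b - x by rewrite (le_trans knd)// ge_min lexx orbT.
by move=> ? ?; apply/andP; split; lra.
Qed.

(** The formula holds on every compact subinterval by the substitution rule for
increasing functions; nonnegativity lets both sides pass to the limit along an
exhaustion, so nothing is asked of F, f and G at the endpoints.  In particular
G may be singular there and F may be unbounded. *)
Lemma ge0_integration_by_substitution_oo (F f G : R -> R) (a b : R) : a < b ->
  {in `]a, b[, forall x : R, is_derive x 1 F (f x)} ->
  {in `]a, b[, forall x, 0 < f x} ->
  {in `]a, b[, continuous f} ->
  {in `]a, b[, forall x, 0 <= G (F x)} ->
  {in `]a, b[, forall x, {for F x, continuous G}} ->
  (\int[mu]_(y in F @` `]a, b[) (G y)%:E =
   \int[mu]_(x in `]a, b[) (G (F x) * f x)%:E)%E.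
Proof.
move=> ab dF f0 cf G0 cG.
pose k n : R := (b - a) / n.+2%:R.
have ba0 : 0 < b - a by rewrite subr_gt0.
have k0 n : 0 < k n by rewrite divr_gt0.
have kh n : k n <= (b - a) / 2 by rewrite ler_pM2l// lef_pV2// ?posrE// ler_nat.
have ks n : k n.+1 <= k n by rewrite ler_pM2l// lef_pV2// ?posrE// ler_nat.
pose I n := `[a + k n, b - k n]%classic.
have Isub n x : x \in `[a + k n, b - k n] -> x \in `]a, b[.
  by have := k0 n; rewrite !in_itv/= => ? /andP[? ?]; apply/andP; split; lra.
have cF : {in `]a, b[, continuous F}.
  move=> x xab; apply: differentiable_continuous; apply/derivable1_diffP.
  by have [] := dF x xab.
have incF : {in `]a, b[ &, {homo F : x y / x < y}}.
  move=> x y xab yab xy.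
  have sub z : z \in `[x, y] -> z \in `]a, b[.
    move: xab yab; rewrite !in_itv/= => /andP[? ?] /andP[? ?] /andP[? ?].
    by apply/andP; split; lra.
  have [z /subset_itv_oo_cc/sub||c /subset_itv_oo_cc/sub cab h] :=
      @MVT _ F f x y xy.
  - exact: dF.
  - by apply: continuous_in_subspaceT => z /set_mem/= /sub; exact: cF.
  - by rewrite -subr_gt0 h mulr_gt0 ?f0// subr_gt0.
have kab n : a + k n <= b - k n by have := kh n; lra.
have ina n : a + k n \in `]a, b[ by apply: (Isub n); rewrite in_itv/= lexx kab.
have inb n : b - k n \in `]a, b[ by apply: (Isub n); rewrite in_itv/= lexx kab.
have leF : {in `]a, b[ &, {homo F : x y / x <= y}}.
  move=> x y xab yab; rewrite le_eqVlt => /predU1P[->//|xy].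
  by apply: ltW; exact: incF.
(* Images of compact subintervals are compact intervals, by the intermediate
   value theorem. *)
have FI n : F @` I n = `[F (a + k n), F (b - k n)]%classic.
  apply/seteqP; split=> [_ [x Ix <-]|y Jy]/=.
    have xab := Isub _ _ Ix.
    move: Ix; rewrite /I/= in_itv/= => /andP[ax xb].
    by rewrite in_itv/= !leF.
  have [||x xI <-] := @IVT R F (a + k n) (b - k n) y (kab n).
  - by apply: continuous_in_subspaceT => z /set_mem/= /Isub; exact: cF.
  - move: Jy; rewrite /= in_itv/= => /andP[h1 h2].
    rewrite min_l ?max_r ?h1//; last by rewrite leF.
    by rewrite leF.
  - by exists x.
have IE : \bigcup_n I n = `]a, b[%classic by exact: itvoo_bigcup.
have FIE : \bigcup_n (F @` I n) = F @` `]a, b[ by rewrite -IE image_bigcup.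
have nI : nondecreasing_seq I.
  apply/nondecreasing_seqP => n; rewrite subsetEset => x; rewrite /I/= !in_itv/=.
  by have := ks n; move=> ? /andP[? ?]; apply/andP; split; lra.
have nFI : nondecreasing_seq (fun n => F @` I n).
  move=> m n mn; rewrite subsetEset; apply: image_subset.
  by rewrite -subsetEset; exact: nI.
have cGI n : {within `[F (a + k n), F (b - k n)], continuous G}.
  apply: continuous_in_subspaceT => y; rewrite -FI => /set_mem[x /Isub xab <-].
  exact: cG.
have cGFI n : {within I n, continuous (fun x => G (F x) * f x)}.
  apply: continuous_in_subspaceT => x /set_mem/= /Isub xab.
  apply: cvgM; last exact: cf.
  by apply: continuous_comp; [exact: cF|exact: cG].
have eqn n : (\int[mu]_(y in F @` I n) (G y)%:E =
    \int[mu]_(x in I n) (G (F x) * f x)%:E)%E.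
  rewrite FI.
  have F'E x : x \in `]a, b[ -> derive1 F x = f x.
    by move=> xab; rewrite derive1E; have [_ ->] := dF x xab.
  have cvgf (c : R) (X : set_system R) : Filter X -> c \in `]a, b[ ->
      X `=>` nbhs c -> derive1 F x @[x --> X] --> f c.
    move=> FX cab Xc.
    have : f x @[x --> X] --> f c.
      by apply: cvg_trans (cf c cab); apply: cvg_app.
    apply: cvg_trans; apply: near_eq_cvg; apply: Xc.
    have := @near_in_itvoo _ a b c cab; apply: filterS => y yab.
    exact/esym/F'E.
  rewrite (@integration_by_substitution_increasing R F G _ _ (kab n)) //.
  - apply: eq_integral => x /set_mem/= /Isub xab.
    by rewrite !fctE F'E.
  - by move=> x y /Isub xab /Isub yab; exact: incF.
  - move=> x /subset_itv_oo_cc/Isub xab.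
    by rewrite /continuous_at F'E//; apply: cvgf.
  - apply/cvg_ex; exists (f (a + k n)); apply: cvgf => //.
    exact: cvg_within.
  - apply/cvg_ex; exists (f (b - k n)); apply: cvgf => //.
    exact: cvg_within.
  - split.
    + by move=> x /subset_itv_oo_cc/Isub /dF[].
    + by apply: cvg_at_right_filter; exact: cF.
    + by apply: cvg_at_left_filter; exact: cF.
have L : (\int[mu]_(y in F @` I n) (G y)%:E @[n --> \oo] -->
          \int[mu]_(y in F @` `]a, b[) (G y)%:E)%E.
  rewrite -FIE; apply: ge0_nondecreasing_set_cvg_integral => //.
  - by move=> n; rewrite FI; exact: measurable_itv.
  - move=> n; apply/measurable_EFinP; rewrite FI.
    exact: subspace_continuous_measurable_fun.
  - by move=> n y [x /Isub xab <-]; rewrite lee_fin; exact: G0.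
have L' : (\int[mu]_(x in I n) (G (F x) * f x)%:E @[n --> \oo] -->
          \int[mu]_(x in `]a, b[) (G (F x) * f x)%:E)%E.
  rewrite -IE; apply: ge0_nondecreasing_set_cvg_integral => //.
  - by move=> n; exact: measurable_itv.
  - move=> n; apply/measurable_EFinP.
    by apply: subspace_continuous_measurable_fun => //; exact: measurable_itv.
  - by move=> n x /Isub xab; rewrite lee_fin mulr_ge0 ?G0// ltW// f0.
move: L; under eq_fun do rewrite eqn; move=> L.
exact: cvg_unique L L'.
Qed.

End substitution.

(** * Exchange of integrals and elementary integrals *)

Section elementary.
Context {R : realType}.
Local Notation mu := (@lebesgue_measure R).

(** Tonelli's theorem is about measurable functions on the whole plane; extending
the integrand by 0 outside D x E reduces the case of two sets to it. *)
Lemma ge0_integral_swap (D E : set R) (f : R -> R -> R) :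
  measurable D -> measurable E ->
  measurable_fun (D `*` E) (fun z : R * R => f z.1 z.2) ->
  (forall x y, D x -> E y -> 0 <= f x y) ->
  (\int[mu]_(x in D) \int[mu]_(y in E) (f x y)%:E =
   \int[mu]_(y in E) \int[mu]_(x in D) (f x y)%:E)%E.
Proof.
move=> mD mE mf f0.
pose g := (fun z : R * R => (f z.1 z.2)%:E) \_ (D `*` E).
have mg : measurable_fun setT g.
  apply/(measurable_restrictT _ _).1; first exact: measurableX.
  exact/measurable_EFinP.
have g0 z : (0 <= g z)%E.
  by apply: erestrict_ge0 => -[x y] [/= Dx Ey]; rewrite lee_fin f0.
have gE x y : g (x, y) = if (x \in D) && (y \in E) then (f x y)%:E else 0%E.
  rewrite /g patchE; congr (if _ then _ else _).
  by apply/idP/andP => [/set_mem[]/= ? ?|[/set_mem ? /set_mem ?]];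
    [split; exact/mem_set|exact/mem_set].
rewrite integral_mkcond [RHS]integral_mkcond.
transitivity (\int[mu]_x \int[mu]_y g (x, y))%E.
  apply/esym.
  apply: eq_integral => x _; rewrite patchE; case: ifPn => xD.
    rewrite [RHS]integral_mkcond; apply: eq_integral => y _.
    by rewrite gE xD patchE.
  by apply: integral0_eq => y _; rewrite gE (negbTE xD).
rewrite (@fubini_tonelli _ _ _ _ R mu mu g mg g0).
apply: eq_integral => y _; rewrite patchE; case: ifPn => yE.
  rewrite [RHS]integral_mkcond; apply: eq_integral => x _.
  by rewrite gE yE andbT patchE.
by apply: integral0_eq => x _; rewrite gE (negbTE yE) andbF.
Qed.

Lemma continuous_powR_gt0 (s u : R) : 0 < u -> {for u, continuous (@powR R ^~ s)}.
Proof.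
move=> u0; apply: differentiable_continuous; apply/derivable1_diffP.
by have [] := is_derive1_powR s u0.
Qed.

(** For s < 1 the integrand is singular at 0, hence the substitution u |-> u^s on
the open interval instead of the fundamental theorem of calculus on the closed
one. *)
Lemma integral_powR_oo (s v : R) : 0 < s -> 0 < v ->
  (\int[mu]_(u in `]0%R, v[) (u `^ (s - 1))%:E = (v `^ s / s)%:E)%E.
Proof.
move=> s0 v0.
have pos (u : R) : u \in `]0, v[ -> 0 < u by rewrite in_itv/= => /andP[].
have := @ge0_integration_by_substitution_oo R (@powR R ^~ s)
  (fun u => s * u `^ (s - 1)) (cst s^-1) 0 v v0.
have -> : (@powR R ^~ s) @` `]0, v[ = `]0, (v `^ s)[%classic.
  apply/seteqP; split=> [_ [u /= + <-]|w /=]; rewrite !in_itv/=.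
    move=> /andP[u0 uv]; rewrite powR_gt0//=.
    by rewrite gt0_ltr_powR// nnegrE ltW.
  move=> /andP[w0 wv]; exists (w `^ s^-1).
    rewrite in_itv/= powR_gt0//=.
    rewrite -[ltRHS](powRr1 (ltW v0)) -(divff (lt0r_neq0 s0)) powRrM.
    by rewrite gt0_ltr_powR ?invr_gt0 ?nnegrE ?powR_ge0// ltW.
  by rewrite -powRrM mulVf ?gt_eqF// powRr1// ltW.
move=> subst; rewrite mulrC EFinM.
transitivity (\int[mu]_(y in `]0%R, (v `^ s)%R[) (cst s^-1 y)%:E)%E; last first.
  rewrite [LHS](integral_cst mu _ s^-1%:E)//.
  by rewrite /= lebesgue_measure_itv/= lte_fin powR_gt0// oppr0 adde0.
rewrite subst.
- by apply: eq_integral => u _; rewrite /= mulKf ?gt_eqF.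
- by move=> u /pos u0; exact: is_derive1_powR.
- by move=> u /pos u0; rewrite mulr_gt0 ?powR_gt0.
- move=> u /pos u0; apply: cvgM; first exact: cvg_cst.
  exact: continuous_powR_gt0.
- by move=> u _; rewrite /= invr_ge0 ltW.
- by move=> u _; exact: cvg_cst.
Qed.

Lemma is_derive_expRNM (k x : R) :
  is_derive x 1 (fun u => expR (- (u * k))) (- k * expR (- (x * k))).
Proof.
have dh : is_derive x 1 (fun u : R => - (u * k)) (- k).
  by apply: is_derive_eq; rewrite scaler0 add0r /GRing.scale/= mulr1.
apply: (@is_derive_eq _ _ _ (expR \o (fun u : R => - (u * k)))).
by rewrite /= mulrC.
Qed.

Lemma continuous_expRNM (k : R) : continuous (fun u : R => expR (- (u * k))).
Proof. exact: is_derive_continuous (is_derive_expRNM k). Qed.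

Lemma measurable_expRNM (k : R) (D : set R) :
  measurable_fun D (fun u : R => expR (- (u * k))).
Proof.
apply: measurable_funTS; apply: continuous_measurable_fun.
exact: continuous_expRNM.
Qed.

Lemma is_derive_antiderivative_expRNM (k u : R) : k != 0 ->
  is_derive u 1 (fun u => - k^-1 * expR (- (u * k))) (expR (- (u * k))).
Proof.
move=> k0; have d := is_derive_expRNM k u.
apply: is_derive_eq.
by rewrite /GRing.scale/= mulrA mulrNN mulVf// mul1r.
Qed.

Lemma integral_expRNM_oo (k t : R) : 0 < k -> 0 < t ->
  (\int[mu]_(u in `]0%R, t[) (expR (- (u * k)))%:E =
   ((1 - expR (- (t * k))) / k)%:E)%E.
Proof.
move=> k0 t0.
pose F (u : R) := - k^-1 * expR (- (u * k)).
have dF u := is_derive_antiderivative_expRNM k u (lt0r_neq0 k0).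
have cF : continuous F by exact: is_derive_continuous dF.
transitivity (\int[mu]_(u in `[0%R, t]) (expR (- (u * k)))%:E)%E.
  by rewrite [RHS]integral_itv_bndoo//; apply/measurable_EFinP;
    exact: measurable_expRNM.
rewrite (@continuous_FTC2 _ _ F _ _ t0)//.
- by rewrite -EFinB /F mul0r oppr0 expR0; congr EFin; ring.
- exact/continuous_subspaceT/continuous_expRNM.
- split.
  + by move=> u _; have [] := dF u.
  + exact/cvg_at_right_filter/cF.
  + exact/cvg_at_left_filter/cF.
- by move=> u _; rewrite derive1E; have [_ ->] := dF u.
Qed.

Lemma integral_expRNM_oy (k v : R) : 0 < k ->
  (\int[mu]_(u in `]v, +oo[) (expR (- (u * k)))%:E = (expR (- (v * k)) / k)%:E)%E.
Proof.
move=> k0.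
pose F (u : R) := - k^-1 * expR (- (u * k)).
have dF u := is_derive_antiderivative_expRNM k u (lt0r_neq0 k0).
have cF : continuous F by exact: is_derive_continuous dF.
rewrite integral_itv_obnd_cbnd; last first.
  by apply/measurable_EFinP; exact: measurable_expRNM.
rewrite (@ge0_continuous_FTC2y _ (fun u => expR (- (u * k))) F v 0)//.
- by rewrite -EFinB /F; congr EFin; ring.
- exact/continuous_subspaceT/continuous_expRNM.
- rewrite -(mulr0 (- k^-1)); apply: cvgM; first exact: cvg_cst.
  apply: (cvg_comp (fun u : R => u * k) (fun u => expR (- u))); last first.
    exact: cvgr_expR.
  exact: gt0_cvgMly.
- exact/cvg_at_right_filter/cF.
- by move=> u _; rewrite derive1E; have [_ ->] := dF u.
Qed.

End elementary.

(** * Euler's integral: recurrence, interpolation, finiteness *)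

Section gamma.
Context {R : realType}.
Local Notation mu := (@lebesgue_measure R).

Lemma measurable_gamma_integrand (s : R) (D : set R) :
  measurable_fun D (fun u : R => u `^ (s - 1) * expR (- u)).
Proof.
apply: measurable_funTS; apply: measurable_funM.
  exact: measurable_powR.
by apply: measurableT_comp => //; exact: measurable_expR.
Qed.

Lemma gamma_integrand_ge0 (s u : R) : 0 <= u `^ (s - 1) * expR (- u).
Proof. by rewrite mulr_ge0 ?powR_ge0 ?expR_ge0. Qed.

Lemma Gamma_ge0 (s : R) : (0 <= Gamma s)%E.
Proof. by apply: integral_ge0 => u _; rewrite lee_fin gamma_integrand_ge0. Qed.

Lemma Gamma1 : Gamma 1 = 1%:E :> \bar R.
Proof.
transitivity (\int[mu]_(u in `]0%R, +oo[) (expR (- (u * 1)))%:E)%E.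
  by apply: eq_integral => u _; rewrite subrr powRr0 mul1r mulr1.
by rewrite integral_expRNM_oy// mul0r oppr0 expR0 divr1.
Qed.

Lemma integral_mulr_indic (D E : set R) (g : R -> R) : E `<=` D ->
  (\int[mu]_(v in D) (g v * \1_E v)%:E = \int[mu]_(v in E) (g v)%:E)%E.
Proof.
move=> ED; rewrite -{2}(setIidr ED) integral_mkcondr.
apply: eq_integral => v _; rewrite patchE indicE.
by case: (v \in E); rewrite ?mulr1 ?mulr0.
Qed.

(** Integrate u^(s-1) e^(-v) over the triangle 0 < u < v in both orders: the inner
integral is u^(s-1) e^(-u) in one order and v^s e^(-v) / s in the other.  Unlike
integration by parts, this needs no boundary terms at 0 and +oo. *)
Lemma GammaS (s : R) : 0 < s -> Gamma (s + 1) = (s%:E * Gamma s)%E.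
Proof.
move=> s0; pose P : set R := `]0, +oo[%classic.
pose f (u v : R) := u `^ (s - 1) * expR (- v) * (if (u < v)%R then 1 else 0).
have mP : measurable P by exact: measurable_itv.
have posP (u : R) : P u -> 0 < u by rewrite /P/= in_itv/= andbT.
have e1 : Gamma s = (\int[mu]_(u in P) \int[mu]_(v in P) (f u v)%:E)%E.
  apply: eq_integral => u /set_mem/posP u0.
  have uP : `]u, +oo[ `<=` P.
    by move=> v; rewrite /P/= !in_itv/= !andbT; exact: lt_trans.
  transitivity (\int[mu]_(v in P)
      (u `^ (s - 1) * expR (- (v * 1)) * \1_(`]u, +oo[%classic) v)%:E)%E.
    rewrite (integral_mulr_indic P _ _ uP).
    under eq_integral do rewrite EFinM.
    rewrite ge0_integralZl_EFin ?powR_ge0//.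
    - by rewrite integral_expRNM_oy// -EFinM mulr1 divr1.
    - by apply/measurable_EFinP; exact: measurable_expRNM.
  apply: eq_integral => v _; rewrite /f mulr1 indicE mem_setE in_itv/= andbT.
  by case: ifP.
have e2 : (s^-1%:E * Gamma (s + 1) =
           \int[mu]_(v in P) \int[mu]_(u in P) (f u v)%:E)%E.
  rewrite /Gamma -ge0_integralZl_EFin//; last 3 first.
  - by move=> u _; rewrite lee_fin gamma_integrand_ge0.
  - by apply/measurable_EFinP; exact: measurable_gamma_integrand.
  - by rewrite invr_ge0 ltW.
  apply: eq_integral => v /set_mem/posP v0.
  have vP : `]0, v[ `<=` P.
    by move=> u; rewrite /P/= !in_itv/= => /andP[->].
  transitivity (\int[mu]_(u in P)
      (expR (- v) * u `^ (s - 1) * \1_(`]0, v[%classic) u)%:E)%E.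
    rewrite (integral_mulr_indic P _ _ vP).
    under eq_integral do rewrite EFinM.
    rewrite ge0_integralZl_EFin ?expR_ge0//.
    - by rewrite integral_powR_oo// -!EFinM addrK; congr EFin; ring.
    - by move=> u _; rewrite lee_fin powR_ge0.
    - by apply/measurable_EFinP; apply: measurable_funTS; exact: measurable_powR.
  apply: eq_integral => u /set_mem/posP u0.
  by rewrite /f indicE mem_setE in_itv/= u0/= (mulrC (expR _)); case: ifP.
rewrite e1 ge0_integral_swap -?e2//.
- by rewrite muleA -EFinM mulfV ?gt_eqF// mul1e.
- apply: measurable_funTS; apply: measurable_funM.
    apply: measurable_funM.
      exact: (measurableT_comp (measurable_powR _) measurable_fst).
    apply: (measurableT_comp (f := expR)); first exact: measurable_expR.
    by apply: measurableT_comp; last exact: measurable_snd.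
  apply: measurable_fun_ifT => //.
  by apply: measurable_fun_ltr; [exact: measurable_fst|exact: measurable_snd].
- move=> u v _ _; rewrite /f.
  by case: ifP => _; rewrite !mulr_ge0 ?powR_ge0 ?expR_ge0.
Qed.

(** Concavity of x^c: its graph lies below the tangent at x = 1. *)
Lemma powR_le_affine (x c : R) : 0 <= x -> 0 < c < 1 -> x `^ c <= (1 - c) + c * x.
Proof.
move=> x0 /andP[c0 c1].
have := @conjugate_powR R (x `^ c) 1 c^-1 (1 - c)^-1 (powR_ge0 _ _) ler01.
rewrite !invr_gt0 c0 subr_gt0 c1 !invrK => /(_ isT isT).
rewrite subrKC => /(_ erefl).
rewrite -powRrM mulfV ?gt_eqF// powRr1// powR1 mulr1 mul1r => /le_trans; apply.
by rewrite addrC (mulrC c).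
Qed.

(** The tangent bound at u = m for u^c, integrated against u^(p-1) e^(-u).  Choosing
m close to p gives the log-convexity estimates on Gamma used below. *)
Lemma Gamma_interpolation (p c m : R) : 0 < c < 1 -> 0 < m ->
  (Gamma (p + c) <=
   (m `^ c)%:E * ((1 - c)%:E * Gamma p + (c / m)%:E * Gamma (p + 1)))%E.
Proof.
move=> /[dup] c01 /andP[c0 c1] m0.
have c10 : 0 <= 1 - c by rewrite subr_ge0 ltW.
have cm0 : 0 <= c / m by rewrite divr_ge0 ?ltW.
have I0 (s : R) D (u : R) : D u -> (0 <= (u `^ (s - 1) * expR (- u))%:E)%E.
  by rewrite lee_fin gamma_integrand_ge0.
have mI (s : R) (D : set R) :
    measurable_fun D (fun u : R => (u `^ (s - 1) * expR (- u))%:E).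
  by apply/measurable_EFinP; exact: measurable_gamma_integrand.
rewrite /Gamma -!ge0_integralZl_EFin//; [|exact: I0|exact: mI|exact: I0|exact: mI].
have kI0 (k s : R) (D : set R) (u : R) : 0 <= k -> D u ->
    (0 <= k%:E * (u `^ (s - 1) * expR (- u))%:E)%E.
  by move=> k0 _; rewrite mule_ge0 ?lee_fin ?gamma_integrand_ge0.
have mkI (k s : R) (D : set R) :
    measurable_fun D (fun u : R => k%:E * (u `^ (s - 1) * expR (- u))%:E)%E.
  exact: measurable_funeM.
rewrite -ge0_integralD//; [|by move=> u; exact: kI0|exact: mkI
  |by move=> u; exact: kI0|exact: mkI].
rewrite -ge0_integralZl_EFin ?powR_ge0//; last 2 first.
- by move=> u Du; apply: adde_ge0; apply: kI0 Du.
- by apply: emeasurable_funD; exact: mkI.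
apply: ge0_le_integral => //.
- by move=> u; exact: I0.
- exact: mI.
- by apply: measurable_funeM; apply: emeasurable_funD; exact: mkI.
move=> u /=; rewrite in_itv/= andbT => u0.
change (u `^ (p + c - 1) * expR (- u) <=
  m `^ c * ((1 - c) * (u `^ (p - 1) * expR (- u)) +
            c / m * (u `^ (p + 1 - 1) * expR (- u)))).
have uc : u `^ c <= m `^ c * ((1 - c) + c * (u / m)).
  have {1}-> : u = m * (u / m) by rewrite mulrCA mulfV ?mulr1// gt_eqF.
  rewrite powRM ?divr_ge0 ?(ltW u0) ?(ltW m0)//.
  by rewrite ler_wpM2l ?powR_ge0// powR_le_affine// divr_ge0// ltW.
have -> : p + c - 1 = (p - 1) + c by ring.
have -> : p + 1 - 1 = (p - 1) + 1 by ring.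
have un0 : u != 0 by rewrite gt_eqF.
rewrite (@powRD _ u (p - 1) c) ?un0 ?implybT//.
rewrite (@powRD _ u (p - 1) 1) ?un0 ?implybT// (powRr1 (ltW u0)).
set A := u `^ (p - 1); set E := expR (- u).
have AE : 0 <= A * E by rewrite mulr_ge0 ?powR_ge0 ?expR_ge0.
have -> : m `^ c * ((1 - c) * (A * E) + c / m * (A * u * E)) =
  A * E * (m `^ c * ((1 - c) + c * (u / m))) by ring.
by rewrite mulrAC ler_wpM2l.
Qed.

(** Interpolation between Gamma 1 and Gamma 2 bounds Gamma on [1, 2], and the
recurrence carries finiteness to all of ]0, +oo[. *)
Lemma Gamma_fin_num (s : R) : 0 < s -> Gamma s \is a fin_num.
Proof.
move=> s0; rewrite ge0_fin_numE ?Gamma_ge0//.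
have G2 : Gamma 2 = 1%:E :> \bar R.
  by rewrite (_ : 2 = 1 + 1 :> R)// GammaS// Gamma1 mule1.
have h12 (x : R) : 1 < x < 2 -> (Gamma x < +oo)%E.
  move=> /andP[x1 x2]; rewrite -(subrKC 1 x) .
  apply: le_lt_trans (Gamma_interpolation 1 (x - 1) 1 _ _) _ => //.
    by apply/andP; split; lra.
  by rewrite Gamma1 G2 !mule1 -EFinD -EFinM ltry.
have [n sn] : exists n : nat, s <= n.+1%:R.
  exists (Num.Def.archi_bound s); rewrite (le_trans (ltW (archi_boundP (ltW s0))))//.
  by rewrite ler_nat.
elim: n s s0 sn => [|n ih] s s0 sn.
  move: sn; rewrite le_eqVlt => /predU1P[->|s1]; first by rewrite Gamma1 ltry.
  have : (Gamma (s + 1) < +oo)%E by apply: h12; apply/andP; split; lra.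
  rewrite GammaS//; have := Gamma_ge0 s.
  by case: (Gamma s) => [x|//|//]; rewrite ?ltry// gt0_muley// lte_fin.
have [s1|s1] := leP s 1.
  by apply: ih => //; rewrite (le_trans s1)// ler1n.
have -> : s = (s - 1) + 1 by rewrite subrK.
rewrite GammaS ?subr_gt0// lte_mul_pinfty ?lee_fin ?subr_ge0 ?(ltW s1)//.
by apply: ih; rewrite ?subr_gt0// lerBlDr natr1.
Qed.

End gamma.

(** * Moments of powers of the cosine *)

Section cosine_moments.
Context {R : realType}.
Local Notation mu := (@lebesgue_measure R).

(** The form of the mean value theorem that yields the two inequalities on sine
below. *)
Lemma ge0_is_derive_le (f df : R -> R) (a b : R) : a <= b ->
  (forall x : R, is_derive x 1 f (df x)) ->
  (forall x, a <= x <= b -> 0 <= df x) -> f a <= f b.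
Proof.
move=> ab dF df0.
have [|c] := @MVT_segment _ f df a b ab.
- by apply: continuous_subspaceT; exact: is_derive_continuous dF.
- rewrite in_itv => cab h.
  by rewrite -subr_ge0 h mulr_ge0 ?subr_ge0// df0.
Qed.

Lemma sin_le_id (y : R) : 0 <= y -> sin y <= y.
Proof.
move=> y0.
have dF (x : R) : is_derive x 1 (fun u : R => u - sin u) (1 - cos x).
  by apply: is_derive_eq.
have := ge0_is_derive_le _ _ 0 y y0 dF.
rewrite sin0 subrr subr_ge0; apply => x _.
by rewrite subr_ge0 cos_le1.
Qed.

(** This is y <= tan y, without the division by cos y.  It is what turns y^2 cos^2 y
into sin^2 y when the spread of the cosine moments is estimated. *)
Lemma mul_cos_le_sin (y : R) : 0 <= y <= pi -> y * cos y <= sin y.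
Proof.
move=> /andP[y0 ypi].
have dF (x : R) : is_derive x 1 (fun u : R => sin u - u * cos u) (x * sin x).
  apply: is_derive_eq. rewrite /GRing.scale/=; ring.
have := ge0_is_derive_le _ _ 0 y y0 dF.
rewrite sin0 mul0r subrr subr_ge0; apply => x /andP[x0 xy].
by rewrite mulr_ge0// sin_ge0_pi// x0 (le_trans xy).
Qed.

Definition cos_moment (x : R) (n : nat) : R :=
  \int[mu]_(y in `[0, pi / 2]) (cos (2 * x * y) * cos y ^+ n).

Lemma is_derive_cos_mul (k y : R) :
  is_derive y 1 (fun u : R => cos (k * u)) (- k * sin (k * y)).
Proof.
have d : is_derive y 1 (fun u : R => k * u) k.
  by apply: is_derive_eq; rewrite /GRing.scale/= mulr1.
apply: (@is_derive_eq _ _ _ (cos \o (fun u : R => k * u))).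
by rewrite /=; ring.
Qed.

Lemma is_derive_sin_mul (k y : R) :
  is_derive y 1 (fun u : R => sin (k * u)) (k * cos (k * y)).
Proof.
have d : is_derive y 1 (fun u : R => k * u) k.
  by apply: is_derive_eq; rewrite /GRing.scale/= mulr1.
apply: (@is_derive_eq _ _ _ (sin \o (fun u : R => k * u))).
by rewrite /=; ring.
Qed.

Lemma is_derive_cosX (n : nat) (y : R) :
  is_derive y 1 (fun u : R => cos u ^+ n) (- (n%:R * cos y ^+ n.-1 * sin y)).
Proof.
have -> : (fun u : R => cos u ^+ n) = cos ^+ n by rewrite exprfctE.
apply: (is_derive_eq (@is_deriveX _ _ cos n _ _ _ (is_derive_cos y))).
by rewrite /GRing.scale/=; ring.
Qed.

Lemma continuous_cos_moment (x : R) n :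
  continuous (fun y : R => cos (2 * x * y) * cos y ^+ n).
Proof.
move=> y; apply: cvgM.
  exact: (is_derive_continuous _ _ (is_derive_cos_mul _)).
exact: (is_derive_continuous _ _ (is_derive_cosX n)).
Qed.

Lemma integrable_cos_moment (x : R) n :
  mu.-integrable `[0, pi / 2] (EFin \o (fun y : R => cos (2 * x * y) * cos y ^+ n)).
Proof.
apply: continuous_compact_integrable; first exact: segment_compact.
exact/continuous_subspaceT/continuous_cos_moment.
Qed.

Lemma integrable_cos_momentZ (k x : R) n :
  mu.-integrable `[0, pi / 2]
    (EFin \o (fun y : R => k * (cos (2 * x * y) * cos y ^+ n))).
Proof.
pose g := EFin \o (fun y : R => cos (2 * x * y) * cos y ^+ n).
suff : mu.-integrable `[0, pi / 2] (fun y => k%:E * g y)%E by [].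
by apply: integrableZl => //; exact: integrable_cos_moment.
Qed.

(** Two integrations by parts, condensed into one antiderivative F: the derivative of
F is the difference of the two integrands, and F vanishes at both endpoints. *)
Lemma cos_momentSS (x : R) n :
  (n.+2%:R ^+ 2 - 4 * x ^+ 2) * cos_moment x n.+2 =
  (n.+2%:R * n.+1%:R) * cos_moment x n.
Proof.
pose A (y : R) := cos (2 * x * y); pose B (y : R) := sin (2 * x * y).
pose P k (y : R) := cos y ^+ k.
pose F (y : R) :=
  n.+2%:R * (P n.+1 y * sin y * A y) - 2 * x * (P n.+2 y * B y).
pose f (y : R) := (n.+2%:R ^+ 2 - 4 * x ^+ 2) * (A y * P n.+2 y)
  - (n.+2%:R * n.+1%:R) * (A y * P n y).
have dA y := is_derive_cos_mul (2 * x) y.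
have dB y := is_derive_sin_mul (2 * x) y.
have dP k y := is_derive_cosX k y.
have dF (y : R) : is_derive y 1 F (f y).
  have d := is_deriveB
    (is_deriveZ n.+2%:R
      (is_deriveM (is_deriveM (dP n.+1 y) (is_derive_sin y)) (dA y)))
    (is_deriveZ (2 * x) (is_deriveM (dP n.+2 y) (dB y))).
  apply: (is_derive_eq d).
  rewrite /GRing.scale/= /f /A /P !fctE.
  have s2 := sin2cos2 y.
  (* The two sides agree up to a multiple of sin^2 y - (1 - cos^2 y). *)
  have h : n.+2%:R * n.+1%:R * cos y ^+ n * cos (2 * x * y) * sin y ^+ 2 =
      n.+2%:R * n.+1%:R * cos y ^+ n * cos (2 * x * y) * (1 - cos y ^+ 2).
    by rewrite s2.
  rewrite !exprS !expr0 !mulr1 in h *.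
  set M := n.+2%:R in h *; set N := n.+1%:R in h *.
  by lra.
have cF : continuous F by exact: is_derive_continuous dF.
have cf : continuous f.
  move=> y; apply: cvgB; apply: cvgM; try exact: cvg_cst.
    exact: continuous_cos_moment.
  exact: continuous_cos_moment.
have pi0 : 0 < pi / 2 :> R by rewrite divr_gt0 ?pi_gt0.
have F0 : F (pi / 2) - F 0 = 0.
  rewrite /F /P /B cos_pihalf sin0 !(mulr0, mul0r) sin0 !(mulr0, mul0r).
  by rewrite !expr0n/= !(mulr0, mul0r) !subr0.
have intf : \int[mu]_(y in `[0, pi / 2]) f y = 0.
  rewrite /Rintegral (@continuous_FTC2 _ f F _ _ pi0)//.
  - exact: continuous_subspaceT.
  - split.
    + by move=> y _; have [] := dF y.
    + exact/cvg_at_right_filter/cF.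
    + exact/cvg_at_left_filter/cF.
  - by move=> y _; rewrite derive1E; have [_ ->] := dF y.
have ik m := integrable_cos_moment x m.
have ikZ k m := integrable_cos_momentZ k x m.
apply/eqP; rewrite -subr_eq0; apply/eqP; rewrite -intf /f /A /P /cos_moment.
rewrite RintegralB//; [|exact: ikZ..].
by rewrite !RintegralZl//; exact: ik.
Qed.

Lemma cos_moment00 : cos_moment 0 0 = pi / 2.
Proof.
rewrite /cos_moment; under eq_Rintegral do rewrite mulr0 mul0r cos0 expr0 mulr1.
rewrite Rintegral_cst//= lebesgue_measure_itv/= lte_fin divr_gt0 ?pi_gt0//=.
by rewrite subr0 mul1r.
Qed.

Lemma cos_momentx0 (x : R) : x != 0 -> cos_moment x 0 = sin (pi * x) / (2 * x).
Proof.
move=> x0; have x20 : 2 * x != 0 by rewrite mulf_neq0.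
have pi0 : 0 < pi / 2 :> R by rewrite divr_gt0 ?pi_gt0.
pose F (y : R) := (2 * x)^-1 * sin (2 * x * y).
have dF (y : R) : is_derive y 1 F (cos (2 * x * y) * cos y ^+ 0).
  have d := is_deriveZ (2 * x)^-1 (is_derive_sin_mul (2 * x) y).
  by apply: (is_derive_eq d); rewrite /GRing.scale/= mulKf// expr0 mulr1.
have cF : continuous F by exact: is_derive_continuous dF.
rewrite /cos_moment /Rintegral (@continuous_FTC2 _ _ F _ _ pi0)//.
- rewrite /= /F mulr0 sin0 mulr0 subr0 mulrC.
  by congr (sin _ / _); field.
- exact/continuous_subspaceT/continuous_cos_moment.
- split.
  + by move=> y _; have [] := dF y.
  + exact/cvg_at_right_filter/cF.
  + exact/cvg_at_left_filter/cF.
- by move=> y _; rewrite derive1E; have [_ ->] := dF y.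
Qed.

Lemma cos_moment_le (x : R) n : cos_moment x n <= cos_moment 0 n.
Proof.
apply: le_Rintegral => //; [exact: integrable_cos_moment..|].
move=> y /=; rewrite in_itv/= => /andP[y0 ypi].
rewrite mulr0 mul0r cos0 ler_wpM2r ?cos_le1// exprn_ge0//.
by rewrite cos_ge0_pihalf// ypi andbT (le_trans _ y0)// oppr_le0 divr_ge0 ?pi_ge0.
Qed.

(** Since cos (2 x y) = 1 - 2 sin^2 (x y), the loss is at most 2 y^2 cos^2 y cos^n y,
and y cos y <= sin y bounds it by 2 (1 - cos^2 y) cos^n y, which integrates to a
difference of two moments at 0. *)
Lemma cos_moment_ge (x : R) n : 0 <= x <= 1 ->
  cos_moment 0 n.+2 - 2 * (cos_moment 0 n - cos_moment 0 n.+2) <=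
  cos_moment x n.+2.
Proof.
move=> /andP[x0 x1].
have ik z m := integrable_cos_moment z m.
have ikZ k z m := integrable_cos_momentZ k z m.
have -> : cos_moment 0 n.+2 - 2 * (cos_moment 0 n - cos_moment 0 n.+2) =
    \int[mu]_(y in `[0, pi / 2]) (3 * (cos (2 * 0 * y) * cos y ^+ n.+2)
      - 2 * (cos (2 * 0 * y) * cos y ^+ n)).
  rewrite RintegralB// !RintegralZl//.
  by rewrite /cos_moment; lra.
apply: le_Rintegral => //.
- pose g k m := EFin \o (fun y : R => k * (cos (2 * 0 * y) * cos y ^+ m)).
  suff : mu.-integrable `[0, pi / 2] (fun y => g 3%R n.+2 y - g 2%R n y)%E by [].
  by apply: integrableB => //; exact: ikZ.
move=> y /=; rewrite in_itv/= => /andP[y0 ypi].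
have c0 : 0 <= cos y.
  by rewrite cos_ge0_pihalf// ypi andbT (le_trans _ y0)// oppr_le0 divr_ge0 ?pi_ge0.
have yp : y <= pi by rewrite (le_trans ypi)// ler_pdivrMr// ler_peMr ?pi_ge0// ler1n.
have xy0 : 0 <= x * y by rewrite mulr_ge0.
have s0 : 0 <= sin (x * y).
  by rewrite sin_ge0_pi// xy0 (le_trans _ yp)// ler_piMl.
have s1 : sin (x * y) <= y.
  by rewrite (le_trans (sin_le_id _ xy0))// ler_piMl.
have s2 : sin (x * y) * cos y <= sin y.
  rewrite (le_trans _ (mul_cos_le_sin y _)) ?y0//.
  by rewrite ler_wpM2r.
rewrite mulr0 mul0r cos0 !mul1r.
have -> : cos (2 * x * y) = 1 - 2 * sin (x * y) ^+ 2.
  have -> : 2 * x * y = (x * y) *+ 2 by ring.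
  by rewrite cos_mulr2n cos2sin2; ring.
have s3 : (sin (x * y) * cos y) ^+ 2 <= 1 - cos y ^+ 2.
  by rewrite -sin2cos2 ler_pXn2r ?nnegrE ?mulr_ge0// (le_trans _ s2)// mulr_ge0.
have cn : 0 <= cos y ^+ n by rewrite exprn_ge0.
have := ler_wpM2r cn s3; rewrite !exprS expr0 !mulr1; lra.
Qed.

End cosine_moments.

(** * Euler's reflection formula *)

Section reflection.
Context {R : realType}.
Local Notation mu := (@lebesgue_measure R).

Definition rGamma (s : R) : R := fine (Gamma s).

Lemma rGammaE (s : R) : 0 < s -> Gamma s = (rGamma s)%:E.
Proof. by move=> s0; rewrite /rGamma fineK// Gamma_fin_num. Qed.

Lemma rGamma_ge0 (s : R) : 0 <= rGamma s.
Proof. by rewrite fine_ge0// Gamma_ge0. Qed.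

Lemma rGamma1 : rGamma 1 = 1.
Proof. by rewrite /rGamma Gamma1. Qed.

Lemma rGammaS (s : R) : 0 < s -> rGamma (s + 1) = s * rGamma s.
Proof. by move=> s0; rewrite /rGamma GammaS// (rGammaE _ s0). Qed.

(** The recurrence makes both terms of the interpolation bound multiples of
Gamma p. *)
Lemma rGamma_interpolation (p c m : R) : 0 < p -> 0 < c < 1 -> 0 < m ->
  rGamma (p + c) <= m `^ c * ((1 - c) + c / m * p) * rGamma p.
Proof.
move=> p0 c01 m0; have := @Gamma_interpolation R p c m c01 m0.
have [c0 c1] := andP c01.
rewrite !rGammaE ?addr_gt0//.
rewrite lee_fin rGammaS// => /le_trans; apply.
by rewrite le_eqVlt; apply/orP; left; apply/eqP; ring.
Qed.

(** Interpolate x + a between x and x + 1, and x - a between x - 1 and x, both with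
the tangent at m = x: then the powers x^a and x^(1-a) multiply to x. *)
Lemma rGamma_mul_le (x a : R) : 1 < x -> 0 < a < 1 ->
  rGamma (x + a) * rGamma (x - a) <= (1 + a / (x - 1)) * rGamma x ^+ 2.
Proof.
move=> x1 /[dup] a01 /andP[a0 a1].
have x0 : 0 < x by lra.
have y0 : 0 < x - 1 by lra.
have xn0 : x != 0 by rewrite gt_eqF.
have yn0 : x - 1 != 0 by rewrite gt_eqF.
have u1 := rGamma_interpolation _ _ _ x0 a01 x0.
have a01' : 0 < 1 - a < 1 by apply/andP; split; lra.
have u2 := rGamma_interpolation _ _ _ y0 a01' x0.
have eg : rGamma x = (x - 1) * rGamma (x - 1) by rewrite -rGammaS// subrK.
have e : x - 1 + (1 - a) = x - a by ring.
rewrite {}e in u2.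
have eg' : rGamma (x - 1) = rGamma x / (x - 1) by rewrite eg mulrC mulKf.
apply: (le_trans (ler_pM (rGamma_ge0 _) (rGamma_ge0 _) u1 u2)).
have ex : x `^ a * x `^ (1 - a) = x.
  by rewrite -powRD ?xn0 ?implybT// subrKC powRr1// ltW.
set p := x `^ a in ex *; set q := x `^ (1 - a) in ex *.
rewrite eg' le_eqVlt; apply/orP; left; apply/eqP.
transitivity ((p * q) * (((1 - a + a / x * x)) * rGamma x *
   ((1 - (1 - a) + (1 - a) / x * (x - 1)) * (rGamma x / (x - 1))))).
  by ring.
by rewrite ex; field; rewrite ?xn0 ?yn0.
Qed.

(** Interpolate x + 1 between x + a and x + a + 1, and x between x - a and x - a + 1,
again with the tangent at m = x. *)
Lemma rGamma_mul_ge (x a : R) : 1 <= x -> 0 < a < 1 ->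
  rGamma x ^+ 2 <= (1 + x^-1) * (rGamma (x + a) * rGamma (x - a)).
Proof.
move=> x1 /[dup] a01 /andP[a0 a1].
have x0 : 0 < x by lra.
have xn0 : x != 0 by rewrite gt_eqF.
have a01' : 0 < 1 - a < 1 by apply/andP; split; lra.
have xa0 : 0 < x + a by lra.
have ya0 : 0 < x - a by lra.
have u1 := rGamma_interpolation _ _ _ xa0 a01' x0.
have u2 := rGamma_interpolation _ _ _ ya0 a01 x0.
have e : x + a + (1 - a) = x + 1 by ring.
rewrite {}e rGammaS// in u1; rewrite subrK in u2.
have ex : x `^ a * x `^ (1 - a) = x.
  by rewrite -powRD ?xn0 ?implybT// subrKC powRr1// ltW.
have u3 := ler_pM (mulr_ge0 (ltW x0) (rGamma_ge0 _)) (rGamma_ge0 _) u1 u2.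
set p := x `^ a in ex u3; set q := x `^ (1 - a) in ex u3.
rewrite -(ler_pM2l x0) expr2 mulrA; apply: (le_trans u3).
set G := rGamma (x + a) * rGamma (x - a).
have G0 : 0 <= G by rewrite mulr_ge0 ?rGamma_ge0.
have -> : q * (1 - (1 - a) + (1 - a) / x * (x + a)) * rGamma (x + a) *
    (p * (1 - a + a / x * (x - a)) * rGamma (x - a)) =
   (p * q) * ((1 + a * (1 - a) * x^-1) * (1 - a ^+ 2 * x^-1) * G).
  by rewrite /G; field; rewrite xn0.
rewrite ex ler_pM2l// ler_wpM2r//.
have i0 : 0 < x^-1 by rewrite invr_gt0.
have i1 : x^-1 <= 1 by rewrite invf_le1.
have h1 : 0 <= a * (1 - a) * x^-1 by rewrite !mulr_ge0// ltW// subr_gt0.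
have h2 : 0 <= a ^+ 2 * x^-1 by rewrite mulr_ge0 ?sqr_ge0// ltW.
have h3 : a * (1 - a) * x^-1 <= x^-1.
  by rewrite ler_piMl ?(ltW i0)//; nra.
have h4 : 0 <= a * (1 - a) * x^-1 * (a ^+ 2 * x^-1) by rewrite mulr_ge0.
by lra.
Qed.

Lemma rGammaN_gt0 n : 0 < rGamma n.+1%:R.
Proof.
elim: n => [|n ih]; first by rewrite rGamma1.
by rewrite -natr1 rGammaS ?ltr0n// mulr_gt0// ltr0n.
Qed.

Lemma cos_moment_doubleS (x : R) n :
  (n.+1%:R ^+ 2 - x ^+ 2) * cos_moment x n.+1.*2 =
  n.+1%:R * (n%:R + 2^-1) * cos_moment x n.*2.
Proof.
have := cos_momentSS x n.*2; rewrite -doubleS.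
have -> : n.+1.*2%:R = 2 * n.+1%:R :> R by rewrite -muln2 natrM mulrC.
have -> : n.*2.+1%:R = 2 * n%:R + 1 :> R by rewrite -natr1 -muln2 natrM mulrC.
by lra.
Qed.

Lemma cos_moment0_gt0 n : 0 < cos_moment (0 : R) n.*2.
Proof.
elim: n => [|n ih]; first by rewrite cos_moment00 divr_gt0 ?pi_gt0.
have := cos_moment_doubleS 0 n; rewrite expr0n subr0 => e.
have h : 0 < n.+1%:R ^+ 2 * cos_moment (0 : R) n.+1.*2.
  by rewrite e mulr_gt0// mulr_gt0 ?ltr0n// ltr_wpDl.
by rewrite pmulr_rgt0 ?exprn_gt0 ?ltr0n in h.
Qed.

(** For x = 0 the recurrence expresses the moment of order 2n through that of order
2n + 2, so the error in the lower bound becomes a fraction of the moment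
itself. *)
Lemma cos_moment_ratio_ge (x : R) n : 0 <= x <= 1 ->
  (1 - 2 / (2 * n%:R + 1)) * cos_moment 0 n.+1.*2 <= cos_moment x n.+1.*2.
Proof.
move=> x01; have := cos_moment_ge x n.*2 x01; rewrite -doubleS.
apply: le_trans.
have := cos_moment_doubleS 0 n; rewrite expr0n subr0 => e.
have n0 : 0 <= n%:R :> R by [].
have N0 : n.+1%:R != 0 :> R by rewrite pnatr_eq0.
have d0 : 2 * n%:R + 1 != 0 :> R by rewrite gt_eqF//; lra.
have -> : cos_moment (0 : R) n.*2 =
    n.+1%:R / (n%:R + 2^-1) * cos_moment 0 n.+1.*2.
  have d1 : n%:R + 2^-1 != 0 :> R by rewrite gt_eqF//; lra.
  apply: (mulfI (mulf_neq0 N0 d1)).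
  by rewrite -e; field; rewrite mulrC.
rewrite le_eqVlt; apply/orP; left; apply/eqP.
by rewrite -natr1; field; rewrite mulrC.
Qed.

(** The factor (n+1)^2 - a^2 that a step of the recurrence brings into the product of
the two Gamma values is, up to a factor that does not depend on a, the one by
which the cosine moment at a must be multiplied to go back one step.  The
factors on the right match likewise, with 0 in place of a. *)
Lemma rGamma_cos_moment_invariant (a : R) n : 0 < a < 1 ->
  rGamma (n.+1%:R + a) * rGamma (n.+1%:R - a) * cos_moment a n.*2 =
  (rGamma a * rGamma (1 - a) * sin (pi * a) / pi) *
  (rGamma n.+1%:R ^+ 2 * cos_moment 0 n.*2).
Proof.
move=> /andP[a0 a1]; have pi0 : pi != 0 :> R by rewrite gt_eqF ?pi_gt0.
have an0 : a != 0 by rewrite gt_eqF.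
elim: n => [|n ih].
  rewrite cos_moment00 cos_momentx0// rGamma1 addrC rGammaS//.
  by move: pi pi0 => p p0; field; rewrite p0.
set K := _ / pi in ih *.
have N0 : 0 < n.+1%:R :> R by rewrite ltr0n.
have N1 : 1 <= n.+1%:R :> R by rewrite ler1n.
have -> : n.+2%:R + a = n.+1%:R + a + 1 by rewrite -natr1; ring.
have -> : n.+2%:R - a = n.+1%:R - a + 1 by rewrite -natr1; ring.
rewrite -[n.+2%:R]natr1 !rGammaS//; [|lra|lra].
have e1 := cos_moment_doubleS a n.
have e2 := cos_moment_doubleS 0 n; rewrite expr0n subr0 in e2.
set N := n.+1%:R in ih N0 N1 e1 e2 *.
transitivity (rGamma (N + a) * rGamma (N - a) *
   ((N ^+ 2 - a ^+ 2) * cos_moment a n.+1.*2)); first by ring.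
rewrite e1.
transitivity ((rGamma (N + a) * rGamma (N - a) * cos_moment a n.*2) *
   (N * (n%:R + 2^-1))); first by ring.
rewrite ih.
transitivity (K * (rGamma N ^+ 2 * (N * (n%:R + 2^-1) * cos_moment 0 n.*2))).
  by ring.
by rewrite -e2; ring.
Qed.

(** The invariant K is squeezed between 1 - O(1/n) and 1 + O(1/n). *)
Lemma rGamma_reflection (a : R) : 0 < a < 1 ->
  rGamma a * rGamma (1 - a) = pi / sin (pi * a).
Proof.
move=> /[dup] a01 /andP[a0 a1].
have pi0 := @pi_gt0 R.
have s0 : 0 < sin (pi * a).
  by rewrite sin_gt0_pi// mulr_gt0//= gtr_pMr.
pose K := rGamma a * rGamma (1 - a) * sin (pi * a) / pi.
suff K1 : K = 1.
  apply: (mulIf (lt0r_neq0 s0)); rewrite mulfVK ?gt_eqF//.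
  by move: K1 => /(canRL (mulfVK (lt0r_neq0 pi0))); rewrite mul1r.
have K0 : 0 <= K by rewrite divr_ge0 ?(ltW pi0)// !mulr_ge0 ?rGamma_ge0// ltW.
have a01' : 0 <= a <= 1 by rewrite !ltW.
(* The bounds are taken at index n + 2, where the factor 1 - 2 / (2n + 3) of
   the cosine ratio is positive. *)
have bound n : `|K - 1| <= 4 / n.+1%:R.
  have n0 : 0 < n.+1%:R :> R by rewrite ltr0n.
  have n1 : 1 <= n.+1%:R :> R by rewrite ler1n.
  have inv := rGamma_cos_moment_invariant a n.+2 a01; rewrite -/K in inv.
  have N1 : 1 < n.+3%:R :> R by rewrite ltr1n.
  have gle := rGamma_mul_le _ _ N1 a01.
  have gge := rGamma_mul_ge _ _ (ltW N1) a01.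
  have cle := cos_moment_le a n.+2.*2.
  have cge := cos_moment_ratio_ge a n.+1 a01'.
  have d0 := cos_moment0_gt0 n.+2.
  have g0 : 0 < rGamma n.+3%:R ^+ 2 by rewrite exprn_gt0 ?rGammaN_gt0.
  have G0 : 0 <= rGamma (n.+3%:R + a) * rGamma (n.+3%:R - a).
    by rewrite mulr_ge0 ?rGamma_ge0.
  set g := rGamma _ ^+ 2 in inv gle gge g0.
  set G := rGamma _ * rGamma _ in inv gle gge G0.
  set c := cos_moment a _ in inv cle cge.
  set d := cos_moment 0 _ in inv cle cge d0.
  have i0 : 0 < n.+1%:R^-1 :> R by rewrite invr_gt0.
  have i1 : n.+3%:R^-1 <= n.+1%:R^-1 :> R.
    by rewrite lef_pV2 ?posrE// ler_nat -addn2 leq_addr.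
  have i2 : a / (n.+3%:R - 1) <= n.+1%:R^-1.
    have -> : n.+3%:R - 1 = n.+2%:R :> R by rewrite -natr1 addrK.
    apply: (@le_trans _ _ (n.+2%:R^-1)); first by rewrite ler_piMl ?(ltW a1).
    by rewrite lef_pV2 ?posrE// ler_nat.
  have i3 : (2 * n.+1%:R + 1)^-1 <= n.+1%:R^-1 :> R.
    by rewrite lef_pV2 ?posrE//; lra.
  have i4 : (2 * n.+1%:R + 1)^-1 <= 3^-1 :> R.
    by rewrite lef_pV2 ?posrE//; lra.
  have i5 : n.+1%:R^-1 <= 1 :> R by rewrite invf_le1.
  have gd : 0 < g * d by rewrite mulr_gt0.
  have c0 : 0 <= c.
    by apply: le_trans cge; rewrite mulr_ge0 ?(ltW d0)//; lra.
  have Kle : K <= 1 + n.+1%:R^-1.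
    rewrite -(ler_pM2r gd) -inv mulrA.
    apply: (@le_trans _ _ (G * d)); first by rewrite ler_wpM2l.
    by rewrite ler_pM2r// (le_trans gle)// ler_pM2r// lerD2l.
  have Kge : 1 - 2 * n.+1%:R^-1 <= (1 + n.+1%:R^-1) * K.
    rewrite -(ler_pM2r gd) -(mulrA _ K) -inv mulrA.
    apply: (@le_trans _ _ (g * c)).
      rewrite mulrCA ler_pM2l//; apply: le_trans cge.
      by rewrite ler_pM2r// lerD2l lerN2 ler_pM2l.
    rewrite ler_wpM2r//; apply: (le_trans gge).
    by rewrite ler_wpM2r// lerD2l.
  rewrite ler_norml; clearbody K.
  move: n.+1%:R^-1 i0 i5 Kle Kge => i i0 i5 Kle Kge.
  have Ki : K * i <= 2 * i by rewrite ler_pM2r//; lra.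
  by apply/andP; split; lra.
apply/eqP; rewrite -subr_eq0 -normr_le0; apply/ler_addgt0Pr => e e0; rewrite add0r.
have [n ne] : exists n : nat, 4 / e < n%:R.
  exists (Num.Def.archi_bound (4 / e)).
  by apply: archi_boundP; rewrite divr_ge0// ltW.
apply: (le_trans (bound n)).
rewrite ler_pdivrMr ?ltr0n// mulrC -ler_pdivrMr// (le_trans (ltW ne))// ler_nat//.
Qed.

End reflection.

(** * Euler's integral in the angular variable *)

Section angle.
Context {R : realType}.
Local Notation mu := (@lebesgue_measure R).
Local Notation E := (`]0, pi / 2[%classic : set R).

Lemma cos_gt0_0pihalf (x : R) : x \in `]0, pi / 2[ -> 0 < cos x.
Proof.
rewrite in_itv/= => /andP[x0 xpi]; rewrite cos_gt0_pihalf// xpi andbT.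
by rewrite (le_lt_trans _ x0)// oppr_le0 divr_ge0 ?pi_ge0.
Qed.

Lemma sin_gt0_0pihalf (x : R) : x \in `]0, pi / 2[ -> 0 < sin x.
Proof. by rewrite in_itv/= => xpi; rewrite sin_gt0_pihalf. Qed.

Lemma tan_sqr_image (u : R) : 0 < u ->
  (fun x : R => u * tan x ^+ 2) @` `]0, pi / 2[ = `]0, +oo[%classic.
Proof.
move=> u0; apply/seteqP; split => [_ [x /= xE <-]|w /=].
  rewrite in_itv/= andbT mulr_gt0// exprn_gt0// /tan divr_gt0//.
    exact: sin_gt0_0pihalf.
  exact: cos_gt0_0pihalf.
rewrite in_itv/= andbT => w0; exists (atan (Num.sqrt (w / u))).
  rewrite in_itv/= atan_ltpi2 andbT -atan0 lt_atan//.
  by rewrite sqrtr_gt0 divr_gt0.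
rewrite atanK sqr_sqrtr ?divr_ge0 ?ltW// mulrCA divff ?mulr1//.
by rewrite gt_eqF.
Qed.

Lemma continuous_sec_sqr (x : R) : x \in `]0, pi / 2[ ->
  {for x, continuous (fun x : R => sec x ^+ 2)}.
Proof.
move=> xE; have c0 := cos_gt0_0pihalf _ xE.
apply: (@continuous_comp _ _ _ sec (fun y => y ^+ 2)).
  by apply: cvgV; [rewrite gt_eqF|exact: continuous_cos].
exact: exprn_continuous.
Qed.

Lemma continuous_cot_powR (p x : R) : x \in `]0, pi / 2[ ->
  {for x, continuous (fun x : R => cot x `^ p)}.
Proof.
move=> xE; have c0 := cos_gt0_0pihalf _ xE; have s0 := sin_gt0_0pihalf _ xE.
apply: (@continuous_comp _ _ _ cot (@powR R ^~ p)).
  apply: cvgM; first exact: continuous_cos.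
  by apply: cvgV; [rewrite gt_eqF|exact: continuous_sin].
by apply: continuous_powR_gt0; rewrite divr_gt0.
Qed.

Lemma measurable_fun_0pihalf (f : R -> R) :
  {in `]0, pi / 2[, continuous f} -> measurable_fun E f.
Proof.
move=> cf; apply: open_continuous_measurable_fun; first exact: interval_open.
by move=> x /set_mem/= xE; exact: cf.
Qed.

(** The substitution v = u tan^2 x, followed by 1 + tan^2 = sec^2.  The dependence
on u survives only in the exponential. *)
Lemma Gamma_angle (a u : R) : 0 < u ->
  ((u `^ (a - 1) * expR (- u))%:E * Gamma (1 - a) =
  \int[mu]_(x in E)
     (2 * (cot x `^ (2 * a - 1) * sec x ^+ 2) * expR (- (u * sec x ^+ 2)))%:E)%E.
Proof.
move=> u0; have pi0 : 0 < pi / 2 :> R by rewrite divr_gt0 ?pi_gt0.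
have cn (x : R) : x \in `]0, pi / 2[ -> cos x != 0.
  by move=> xE; rewrite gt_eqF// cos_gt0_0pihalf.
have t0 (x : R) : x \in `]0, pi / 2[ -> 0 < tan x.
  by move=> xE; rewrite /tan divr_gt0 ?sin_gt0_0pihalf ?cos_gt0_0pihalf.
pose G (v : R) := v `^ (1 - a - 1) * expR (- v).
pose F (x : R) := u * tan x ^+ 2.
pose f (x : R) := u * (2 * tan x * sec x ^+ 2).
have F0 (x : R) : x \in `]0, pi / 2[ -> 0 < F x.
  by move=> xE; rewrite mulr_gt0// exprn_gt0//; exact: t0.
have f0 (x : R) : x \in `]0, pi / 2[ -> 0 < f x.
  move=> xE; have tx := t0 x xE.
  have sx : 0 < sec x by rewrite invr_gt0 cos_gt0_0pihalf.
  by rewrite mulr_gt0// mulr_gt0 ?exprn_gt0// mulr_gt0.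
have dF : {in `]0, pi / 2[, forall x : R, is_derive x 1 F (f x)}.
  move=> x xE; have d := is_derive_tan (cn x xE).
  have d2 := is_deriveZ u (is_deriveM d d).
  have -> : F = (u \*: (tan * tan)).
    by apply/funext => y /=; rewrite /F expr2.
  by apply: (is_derive_eq d2); rewrite /GRing.scale/= /f /sec exprVn; ring.
have cF : {in `]0, pi / 2[, continuous F}.
  move=> x xE; apply: differentiable_continuous; apply/derivable1_diffP.
  by have [] := dF x xE.
have cf : {in `]0, pi / 2[, continuous f}.
  move=> x xE; apply: cvgM; first exact: cvg_cst.
  apply: cvgM; last exact: continuous_sec_sqr.
  by apply: cvgM; [exact: cvg_cst|exact/continuous_tan/cn].
have cG : {in `]0, pi / 2[, forall x : R, {for F x, continuous G}}.
  move=> x xE; apply: cvgM; first exact/continuous_powR_gt0/F0.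
  apply: (@continuous_comp _ _ _ (fun v : R => - v) expR).
    exact: opp_continuous.
  exact: continuous_expR.
rewrite /Gamma -(tan_sqr_image _ u0).
rewrite (@ge0_integration_by_substitution_oo R F f G _ _ pi0)//; last first.
  by move=> x _; exact: gamma_integrand_ge0.
rewrite -ge0_integralZl_EFin//; last 3 first.
- move=> x /= xE; rewrite lee_fin mulr_ge0 ?gamma_integrand_ge0//.
  exact/ltW/f0.
- apply/measurable_EFinP; apply: measurable_fun_0pihalf => x xE; apply: cvgM.
    by apply: continuous_comp; [exact: cF|exact: cG].
  exact: cf.
- exact: gamma_integrand_ge0.
apply: eq_integral => x /set_mem/= xE.
rewrite -EFinM; congr EFin.
have tx := t0 x xE; have c0 := cos_gt0_0pihalf _ xE; have s0 := sin_gt0_0pihalf _ xE.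
have secE : sec x ^+ 2 = 1 + tan x ^+ 2.
  by rewrite -cos2_tan2 ?cn// /sec exprVn.
have -> : expR (- (u * sec x ^+ 2)) = expR (- u) * expR (- (u * tan x ^+ 2)).
  by rewrite -expRD secE; congr expR; ring.
have e1 : u `^ (a - 1) * (u * tan x ^+ 2) `^ (1 - a - 1) * (u * tan x) =
          cot x `^ (2 * a - 1).
  have -> : cot x = (tan x)^-1 by rewrite /cot /tan invf_div.
  have -> : 1 - a - 1 = - a by ring.
  rewrite powRM ?sqr_ge0 ?(ltW u0)// -powR_mulrn ?(ltW tx)// -powRrM.
  rewrite -(powR_inv1 (ltW tx)) -powRrM.
  transitivity ((u `^ (a - 1) * u `^ (- a) * u `^ 1) *
    (tan x `^ (2%:R * (- a)) * tan x `^ 1)).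
    by rewrite !powRr1 ?ltW//; ring.
  rewrite -!powRD ?(gt_eqF u0) ?(gt_eqF tx) ?implybT//.
  have -> : a - 1 + - a + 1 = 0 by ring.
  by rewrite powRr0 mul1r; congr (_ `^ _); ring.
by rewrite -e1 /G /F /f; ring.
Qed.

(** Stated for a set D so that one exchange of integrals serves both the incomplete
gamma function and Gamma itself. *)
Lemma integral_gamma_mul_Gamma (a : R) (D : set R) :
  measurable D -> D `<=` `]0, +oo[ ->
  ((\int[mu]_(u in D) (u `^ (a - 1) * expR (- u))%:E) * Gamma (1 - a) =
  \int[mu]_(x in E) ((2 * (cot x `^ (2 * a - 1) * sec x ^+ 2))%:E *
    \int[mu]_(u in D) (expR (- (u * sec x ^+ 2)))%:E))%E.
Proof.
move=> mD D0.
pose h (x : R) := cot x `^ (2 * a - 1) * sec x ^+ 2.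
have h0 x : 0 <= h x by rewrite mulr_ge0 ?powR_ge0 ?sqr_ge0.
have ch : {in `]0, pi / 2[, continuous h}.
  move=> x xE; apply: cvgM; last exact: continuous_sec_sqr.
  exact: continuous_cot_powR.
have msec : measurable_fun E (fun x : R => sec x ^+ 2).
  by apply: measurable_fun_0pihalf => x; exact: continuous_sec_sqr.
have mE : measurable E by exact: measurable_itv.
have lift (g : R -> R) : measurable_fun E g ->
    measurable_fun (D `*` E) (fun z : R * R => g z.2).
  move=> mg; apply: (measurable_comp mE _ mg).
    by move=> _ [[u x] [_ xE] <-].
  by apply: measurable_funTS; exact: measurable_snd.
pose k (u x : R) := 2 * h x * expR (- (u * sec x ^+ 2)).
have k0 u x : 0 <= k u x by rewrite mulr_ge0 ?expR_ge0// mulr_ge0.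
have mk : measurable_fun (D `*` E) (fun z : R * R => k z.1 z.2).
  apply: measurable_funM.
    apply: (lift (fun x => 2 * h x)); apply: measurable_funM => //.
    exact: measurable_fun_0pihalf.
  apply: measurableT_comp; first exact: measurable_expR.
  apply: measurableT_comp => //; apply: measurable_funM; last first.
    exact: (lift (fun x => sec x ^+ 2)).
  by apply: measurable_funTS; exact: measurable_fst.
rewrite -ge0_integralZr ?Gamma_ge0//; last 2 first.
- by apply/measurable_EFinP; exact: measurable_gamma_integrand.
- by move=> u _; rewrite lee_fin gamma_integrand_ge0.
transitivity (\int[mu]_(u in D) \int[mu]_(x in E) (k u x)%:E)%E.
  apply: eq_integral => u /set_mem/D0; rewrite /= in_itv/= andbT => u0.
  exact: Gamma_angle.
rewrite ge0_integral_swap//.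
apply: eq_integral => x _; rewrite -ge0_integralZl_EFin//.
- by apply/measurable_EFinP; exact: measurable_expRNM.
- by rewrite mulr_ge0// h0.
Qed.

Lemma ge0_integralZl_0pihalf (k : R) (q : R -> R) : 0 <= k ->
  {in `]0, pi / 2[, continuous q} -> (forall x, E x -> 0 <= q x) ->
  (\int[mu]_(x in E) (k * q x)%:E = k%:E * \int[mu]_(x in E) (q x)%:E)%E.
Proof.
move=> k0 cq q0; rewrite -ge0_integralZl_EFin//.
by apply/measurable_EFinP; exact: measurable_fun_0pihalf.
Qed.

Lemma continuous_expRN_sec_sqr (t : R) :
  {in `]0, pi / 2[, continuous (fun x : R => expR (- (t * sec x ^+ 2)))}.
Proof.
move=> x xE; apply: (@continuous_comp _ _ _ (fun x => - (t * sec x ^+ 2)) expR).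
  by apply: cvgN; apply: cvgM; [exact: cvg_cst|exact: continuous_sec_sqr].
exact: continuous_expR.
Qed.

Lemma lower_gamma_mul_Gamma (a t : R) : 0 <= t ->
  (lower_gamma a t * Gamma (1 - a) = 2%:E * \int[mu]_(x in E)
      (((1 - expR (- (t * sec x ^+ 2))) * cot x `^ (2 * a - 1))%R%:E))%E.
Proof.
move=> t0; rewrite /lower_gamma integral_gamma_mul_Gamma//; last first.
  by move=> u /=; rewrite !in_itv/= => /andP[->].
rewrite -ge0_integralZl_0pihalf//; last 2 first.
- move=> x xE; apply: cvgM; last exact: continuous_cot_powR.
  by apply: cvgB; [exact: cvg_cst|exact: continuous_expRN_sec_sqr].
- move=> x _; rewrite mulr_ge0 ?powR_ge0// subr_ge0 -expR0 ler_expR oppr_le0.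
  by rewrite mulr_ge0 ?sqr_ge0.
apply: eq_integral => x /set_mem/= xE.
have sx : 0 < sec x by rewrite invr_gt0 cos_gt0_0pihalf.
have s0 : 0 < sec x ^+ 2 by rewrite exprn_gt0.
move: t0; rewrite le_eqVlt => /predU1P[<-|t0].
  by rewrite set_itvoo0 integral_set0 mule0 mul0r oppr0 expR0 subrr mul0r mulr0.
rewrite integral_expRNM_oo// -EFinM; congr EFin.
by field; rewrite gt_eqF.
Qed.

Lemma Gamma_mul_Gamma (a : R) :
  (Gamma a * Gamma (1 - a) =
   2%:E * \int[mu]_(x in E) (cot x `^ (2 * a - 1))%:E)%E.
Proof.
rewrite {1}/Gamma integral_gamma_mul_Gamma//.
rewrite -ge0_integralZl_0pihalf//; last 2 first.
- by move=> x; exact: continuous_cot_powR.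
- by move=> x _; exact: powR_ge0.
apply: eq_integral => x /set_mem/= xE.
have sx : 0 < sec x by rewrite invr_gt0 cos_gt0_0pihalf.
have s0 : 0 < sec x ^+ 2 by rewrite exprn_gt0.
rewrite integral_expRNM_oy// mul0r oppr0 expR0 -EFinM; congr EFin.
by field; rewrite gt_eqF.
Qed.

End angle.

Theorem lemma2p6 (R : realType) (a t : R) (ha0 : 0 < a) (ha1 : a < 1)
    (ht : 0 <= t) :
  (lower_gamma a t * Gamma (1 - a) =
    2%:E * \int[@lebesgue_measure R]_(x in `]0%R, (pi / 2)%R[)
      (((1 - expR (- (t * sec x ^+ 2))) * cot x `^ (2 * a - 1))%R%:E))%E
  /\
  (2%:E * \int[@lebesgue_measure R]_(x in `]0%R, (pi / 2)%R[)
      (((1 - expR (- (t * sec x ^+ 2))) * cot x `^ (2 * a - 1))%R%:E) =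
    (pi * csc (pi * a))%R%:E -
    2%:E * \int[@lebesgue_measure R]_(x in `]0%R, (pi / 2)%R[)
      ((expR (- (t * sec x ^+ 2)) * cot x `^ (2 * a - 1))%R%:E))%E.
Proof.
split; first exact: lower_gamma_mul_Gamma.
pose w (x : R) := cot x `^ (2 * a - 1).
pose e (x : R) := expR (- (t * sec x ^+ 2)).
have e1 x : e x <= 1.
  by rewrite -expR0 ler_expR oppr_le0 mulr_ge0// sqr_ge0.
have w0 x : 0 <= w x by exact: powR_ge0.
have e0 x : 0 <= e x by exact: expR_ge0.
have cw : {in `]0, pi / 2[, continuous w} by move=> x; exact: continuous_cot_powR.
have ce : {in `]0, pi / 2[, continuous e}.
  by move=> x; exact: continuous_expRN_sec_sqr.
set A := (X in (2%:E * X)%E); set B := (X in (_ - 2%:E * X)%E).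
have A0 : (0 <= A)%E.
  by apply: integral_ge0 => x _; rewrite lee_fin mulr_ge0 ?w0// subr_ge0 e1.
have B0 : (0 <= B)%E by apply: integral_ge0 => x _; rewrite lee_fin mulr_ge0 ?e0 ?w0.
have AB : (2%:E * A + 2%:E * B = (pi * csc (pi * a))%:E)%E.
  rewrite -ge0_muleDr//.
  rewrite -ge0_integralD//; last 4 first.
  - by move=> x _; rewrite lee_fin mulr_ge0 ?w0// subr_ge0 e1.
  - apply/measurable_EFinP; apply: measurable_fun_0pihalf => x xE.
    apply: cvgM; last exact: cw.
    by apply: cvgB; [exact: cvg_cst|exact: ce].
  - by move=> x _; rewrite lee_fin mulr_ge0 ?e0 ?w0.
  - apply/measurable_EFinP; apply: measurable_fun_0pihalf => x xE.
    by apply: cvgM; [exact: ce|exact: cw].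
  transitivity (Gamma a * Gamma (1 - a))%E.
    rewrite Gamma_mul_Gamma; congr (_ * _)%E; apply: eq_integral => x _.
    by rewrite -EFinD -mulrDl subrK mul1r.
  rewrite !rGammaE ?subr_gt0// -EFinM rGamma_reflection//.
  by rewrite ha0.
have : (2%:E * A + 2%:E * B)%E \is a fin_num by rewrite AB.
by rewrite fin_numD => /andP[_ finB]; rewrite -AB addeK.
Qed.
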